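(* Let $G$ be a connected regular graph of order $n\ge 3$. Then $$t_{\mathrm{hit}}(G)\le\frac34(n-1)(n+3),\qquad \tau^*(G)\le\frac32n^2-3n.$$ Both leading constants are best possible; that is, neither $\frac34$ nor $\frac32$ can be replaced by a smaller constant as the coefficient of $n^2$ in an upper bound, up to lower-order terms $o(n^2)$, valid for all connected regular graphs of order $n$.
   Context: All graphs are finite, simple and undirected. For vertices $u,v$ of a connected graph $G$, $T_v$ is the first time simple random walk on $G$ visits $v$, and $\mathbb E_u$ is expectation for the walk started at $u$. The maximum hitting time is $t_{\mathrm{hit}}(G)=\max_{u,v}\mathbb E_uT_v$ and the maximum commute time is $\tau^*(G)=\max_{u,v}(\mathbb E_uT_v+\mathbb E_vT_u)$. *)

(* Defs.v *)
From mathcomp Require Import all_boot all_order all_algebra.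
From mathcomp Require Import all_classical all_reals all_analysis.

Set Implicit Arguments.
Unset Strict Implicit.
Unset Printing Implicit Defensive.

Import Order.TTheory GRing.Theory Num.Theory.
Import numFieldNormedType.Exports.

Local Open Scope ring_scope.
Local Open Scope ereal_scope.

Record sgraph := SGraph {
  vertex :> finType;
  adj : rel vertex;
  adj_sym : symmetric adj;
  adj_irr : irreflexive adj
}.

Definition degree (G : sgraph) (x : G) : nat := #|[set y : G | adj x y]|.

Definition connected_graph (G : sgraph) : Prop :=
  forall x y : G, connect (@adj G) x y.

Definition regular_graph (G : sgraph) : Prop :=
  exists d : nat, forall x : G, degree x = d.

Section RandomWalk.
Variables (R : realType) (G : sgraph).

(* Division by zero makes every transition probability out of an isolated
   vertex 0; a connected graph with at least two vertices has none. *)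
Definition srw_step (x y : G) : R := ((adj x y)%:R / (degree x)%:R)%R.

(* A trajectory of [k] steps is the function [i |-> X_i] for [i = 0, ..., k]. *)
Definition traj (k : nat) := {ffun 'I_k.+1 -> G}.

Definition traj_weight (u : G) (k : nat) (x : traj k) : R :=
  ((x ord0 == u)%:R *
   \prod_(i < k) srw_step (x (widen_ord (leqnSn k) i)) (x (lift ord0 i)))%R.

(* The probability, for simple random walk [X] started at [u], of the event
   [(X_0, ..., X_k) \in A]. *)
Definition srw_prob (u : G) (k : nat) (A : {set traj k}) : R :=
  (\sum_(x in A) traj_weight u x)%R.

(* The event [T_v = k], which is determined by the first [k] steps. *)
Definition first_visit (v : G) (k : nat) : {set traj k} :=
  [set x : traj k | (x ord_max == v) && [forall i : 'I_k.+1, (i < k)%N ==> (x i != v)]].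

Definition hit_law (u v : G) (k : nat) : R := srw_prob u (first_visit v k).

Definition never_hit (u v : G) : \bar R :=
  1 - \sum_(0 <= k <oo) (hit_law u v k)%:E.

(* The expectation of the [0, 1, ..., +oo]-valued variable [T_v]; recall that
   [+oo * 0 = 0]. *)
Definition hitting_time (u v : G) : \bar R :=
  \sum_(0 <= k <oo) (k%:R * hit_law u v k)%:E + +oo * never_hit u v.

(* The value [-oo] is taken only on the graph without vertices. *)
Definition max_hitting_time : \bar R :=
  \big[maxe/-oo]_(u : G) \big[maxe/-oo]_(v : G) hitting_time u v.

Definition max_commute_time : \bar R :=
  \big[maxe/-oo]_(u : G) \big[maxe/-oo]_(v : G)
    (hitting_time u v + hitting_time v u).

End RandomWalk.

Arguments max_hitting_time : clear implicits.
Arguments max_commute_time : clear implicits.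

(* Main.v *)
(* For a connected d-regular graph the hitting times are read off a unit current
   flow from u to v with potential f, f v = 0: symmetry of the Laplacian gives
   E_u T_v = d * sum_x f x, and the commute time is d * n * f u.  So it suffices
   to bound the drops of f.  List the vertices by decreasing f, let g_i be the
   i-th gap and k_i the number of edges across the i-th cut.  The current
   through a cut is at most 1, hence g_i <= 1 / k_i, which is at most 3 / (2d)
   unless 3 k_i < 2d.  In the latter case the next d gaps add up to at most
   2 / (d - k_i): consider the cuts i+1 and i+d together; each intermediate cut
   shares at least d - k_i edges with these two.  Thus every such block of d+1
   gaps costs at most (d+1) * 3 / (2d) as well.  Sharpness comes from cubic
   chains of diamonds joined by bridges, where an explicit potential bounds the
   hitting time from below. *)
Require Import Defs.
From mathcomp Require Import all_boot all_order all_algebra.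
From mathcomp Require Import all_classical all_reals all_analysis.
From mathcomp Require Import zify ring lra.
Import Order.TTheory GRing.Theory Num.Theory.
Import numFieldNormedType.Exports.

Set Implicit Arguments.
Unset Strict Implicit.
Unset Printing Implicit Defensive.

Local Open Scope ring_scope.

(** * Edge counts across the cuts of a linearly ordered regular graph *)

Definition edges (A : rel nat) (a b c t : nat) : nat :=
  (\sum_(a <= p < b) \sum_(c <= q < t) A p q)%N.

Section Edges.
Variable A : rel nat.
Local Notation e := (edges A).

Lemma edges_catl a b m c t : (a <= m <= b)%N -> e a b c t = (e a m c t + e m b c t)%N.
Proof. by case/andP=> am mb; rewrite /edges (big_cat_nat am mb). Qed.

Lemma edges_catr a b c t m : (c <= m <= t)%N -> e a b c t = (e a b c m + e a b m t)%N.
Proof.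
case/andP=> cm mt; rewrite /edges -big_split /=.
by apply: eq_bigr => p _; rewrite (big_cat_nat cm mt).
Qed.

Lemma edges_sym a b c t : symmetric A -> e a b c t = e c t a b.
Proof.
move=> sA; rewrite /edges exchange_big_nat /=.
by apply: eq_bigr => q _; apply: eq_bigr => p _; rewrite sA.
Qed.

Lemma edges_le a b c t : (e a b c t <= (b - a) * (t - c))%N.
Proof.
rewrite /edges -(sum_nat_const_nat a b (t - c)); apply: leq_sum => p _.
rewrite -[X in (_ <= X)%N]muln1 -(sum_nat_const_nat c t 1).
by apply: leq_sum => q _; case: (A p q).
Qed.

Lemma edges_row p c t : e p p.+1 c t = (\sum_(c <= q < t) A p q)%N.
Proof. by rewrite /edges big_nat1. Qed.

(** An edge inside the block is counted in both directions, hence no factor 1/2 here and the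
    evenness in [edges_diag_even]. *)
Lemma edges_diag_le a b : irreflexive A -> symmetric A ->
  (e a b a b <= (b - a) * (b - a).-1)%N.
Proof.
move=> iA sA; elim: b => [|b IH]; first by rewrite /edges big_geq.
have [ba|ab] := ltnP b a.
  by rewrite /edges big_geq.
rewrite (@edges_catl a b.+1 b) ?ab ?leqnSn //.
rewrite (@edges_catr a b a b.+1 b) ?(@edges_catr b b.+1 a b.+1 b) ?ab ?leqnSn //.
have -> : e b b.+1 b b.+1 = 0%N by rewrite edges_row big_nat1 iA.
have h1 := edges_le a b b b.+1; rewrite (edges_sym b b.+1 a b sA).
nia.
Qed.

Lemma edges_diag_even a b : irreflexive A -> symmetric A -> ~~ odd (e a b a b).
Proof.
move=> iA sA; elim: b => [|b IH]; first by rewrite /edges big_geq.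
have [ba|ab] := ltnP b a.
  by rewrite /edges big_geq.
rewrite (@edges_catl a b.+1 b) ?ab ?leqnSn //.
rewrite (@edges_catr a b a b.+1 b) ?(@edges_catr b b.+1 a b.+1 b) ?ab ?leqnSn //.
have -> : e b b.+1 b b.+1 = 0%N by rewrite edges_row big_nat1 iA.
rewrite (edges_sym b b.+1 a b sA); lia.
Qed.

End Edges.

Section RegularCuts.
Variables (A : rel nat) (n d : nat).
Hypotheses (sA : symmetric A) (iA : irreflexive A).
Hypothesis regA : forall p, (p < n)%N -> (\sum_(0 <= q < n) A p q)%N = d.
Local Notation e := (edges A).
(* The cut [i] separates the positions [0, ..., i-1] from [i, ..., n-1]. *)
Local Notation k i := (edges A 0 i i n).

Lemma edges_regular a b : (b <= n)%N -> e a b 0 n = ((b - a) * d)%N.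
Proof.
move=> bn; rewrite -(sum_nat_const_nat a b d).
by apply: eq_big_nat => p /andP[_ pb]; rewrite regA ?(leq_trans pb).
Qed.

(** The first [i] vertices have total degree [i * d], of which at most [i (i-1)] stays inside. *)
Lemma cut_prefix_lb i : (i <= n)%N -> (i * d <= k i + i * i.-1)%N.
Proof.
move=> lein; have := edges_regular 0 lein.
rewrite (@edges_catr A _ _ _ _ i) ?lein // !subn0.
have := edges_diag_le 0 i iA sA; rewrite subn0; lia.
Qed.

Lemma cut_suffix_lb i : (i <= n)%N -> ((n - i) * d <= k i + (n - i) * (n - i).-1)%N.
Proof.
move=> lein; have := edges_regular i (leqnn n).
rewrite (@edges_catr A _ _ _ _ i) ?lein // (edges_sym i n 0 i sA).
have := edges_diag_le i n iA sA; lia.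
Qed.

(** The cut is the degree sum [i * d] less twice the number of internal edges. *)
Lemma cut_parity i : (i <= n)%N -> ~~ odd d -> ~~ odd (k i).
Proof.
move=> lein d_even; have := edges_regular 0 lein.
rewrite (@edges_catr A _ _ _ _ i) ?lein // subn0.
have := edges_diag_even 0 i iA sA => h1 h2.
have : ~~ odd (i * d) by rewrite oddM negb_and d_even orbT.
by rewrite -h2 oddD; move: h1; case: odd; case: odd.
Qed.

(** If only [r <= d] vertices lay beyond the cut, each would send at least [d - r + 1] edges across
    it, so that [k i >= r (d - r + 1) >= d]. *)
Lemma small_cut_room i : (i < n)%N -> (3 * k i < 2 * d)%N -> (i + d < n)%N.
Proof.
move=> lin sm; rewrite ltnNge; apply/negP => nid.
have := cut_suffix_lb (ltnW lin).
have : (1 <= n - i <= d)%N by lia.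
move: (n - i)%N => r; nia.
Qed.

(* The vertices i, ..., i+m-1 have total degree m * d; at most k_i of their
   edges go backwards, m(m-1) to one another, and (m-1)(d-m) lead from the last
   m-1 of them into the window i+m, ..., i+d-1. *)
Lemma edges_leave_window i m : (i + d < n)%N -> (0 < m <= d)%N ->
  (d <= k i + e 0 i.+1 (i + m) n + e 0 (i + m) (i + d) n)%N.
Proof.
move=> idn /andP[m0 md].
have deg : e i (i + m) 0 n = (m * d)%N by rewrite edges_regular; [congr muln|]; lia.
have s1 : e i (i + m) 0 n = (e 0 i i (i + m) + e i (i + m) i (i + m) + e i (i + m) (i + m) n)%N.
  rewrite (@edges_catr A i (i + m) 0 n i) ?(edges_sym i (i+m) 0 i sA); last lia.
  rewrite (@edges_catr A i (i + m) i n (i + m)); lia.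
have h1 : (e 0 i i (i + m) <= k i)%N by rewrite (@edges_catr A 0 i i n (i + m)); lia.
have h2 := edges_diag_le i (i + m) iA sA.
have s2 : e i (i + m) (i + m) n = (e i i.+1 (i + m) n + e i.+1 (i + m) (i + m) (i + d)
    + e i.+1 (i + m) (i + d) n)%N.
  rewrite (@edges_catl A i (i + m) i.+1); last lia.
  rewrite (@edges_catr A i.+1 (i + m) (i + m) n (i + d)); lia.
have h3 := edges_le A i.+1 (i + m) (i + m) (i + d).
have h4 : (e i i.+1 (i + m) n <= e 0 i.+1 (i + m) n)%N.
  by rewrite (@edges_catl A 0 i.+1 i) ?leq_addl // leqnSn.
have h5 : (e i.+1 (i + m) (i + d) n <= e 0 (i + m) (i + d) n)%N.
  by rewrite (@edges_catl A 0 (i + m) i.+1) ?leq_addl //; lia.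
have : (i + m - i = m)%N by lia. 
move=> E; rewrite E in h2.
(* Since [m (m-1) + (m-1) (d-m) = (m-1) d], at least [d] of the [m d] edge ends remain for the three
   terms of the claim. *)
have : (m * m.-1 + (i + m - i.+1) * (i + d - (i + m)) + d = m * d)%N.
  have -> : (i + m - i.+1 = m.-1)%N by lia.
  have -> : (i + d - (i + m) = d - m)%N by lia.
  by rewrite (mulnC m) -mulnDr subnKC // -[X in (_ + X)%N]mul1n -mulnDl addn1 prednK.
lia.
Qed.

End RegularCuts.

(** * Potential gaps of a unit flow *)

Section Gaps.
Variables (R : realFieldType) (A : rel nat) (n d : nat) (f : nat -> R).
Hypotheses (sA : symmetric A) (iA : irreflexive A).
Hypothesis regA : forall p, (p < n)%N -> (\sum_(0 <= q < n) A p q)%N = d.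
Hypothesis f_noninc : forall p q, (p <= q < n)%N -> f q <= f p.
Hypothesis flow_le1 : forall l, (0 < l < n)%N ->
  \sum_(0 <= p < l) \sum_(l <= q < n) (A p q)%:R * (f p - f q) <= 1.
Local Notation k i := (edges A 0 i i n).
Local Notation both l j := (edges A 0 (minn l j) (maxn l j) n).
(** As [0.-1 = 0], [g 0] vanishes and sums over all cuts may start at 0. *)
Let g i := f i.-1 - f i.

Lemma gap_ge0 i : (i < n)%N -> 0 <= g i.
Proof. by move=> lin; rewrite /g subr_ge0 f_noninc // leq_pred. Qed.

Lemma gap_telescope p q : (p <= q)%N -> \sum_(p.+1 <= j < q.+1) g j = f p - f q.
Proof.
move=> pq; rewrite big_add1 /= -[f p - f q]opprB -(telescope_sumr f pq) -sumrN.
by apply: eq_bigr => j _; rewrite /g /= opprB.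
Qed.

Lemma bothE l j : (l <= n)%N -> both l j =
  (\sum_(0 <= p < l) \sum_(l <= q < n) (p < j <= q) * A p q)%N.
Proof.
move=> ln; rewrite /edges (big_nat_widen 0 (minn l j) l) ?geq_minl //= big_mkcond /=.
apply: eq_big_nat => p /andP[_ pl]; rewrite leq_min pl /=.
have [pj|jp] := boolP (p < j)%N; last by rewrite big1.
rewrite (big_nat_widenl (maxn l j) l) ?leq_maxl //= big_mkcond /=.
apply: eq_big_nat => q /andP[lq _]; rewrite geq_max lq /=.
by case: (j <= q)%N; rewrite ?mul1n.
Qed.

(** The drop along an edge from [p] to [q] is the sum of the gaps [j] with [p < j <= q]. Exchanging
    the sums weights [g j] by the number of edges that cross both cuts [l] and [j]. *)
Lemma flow_gaps l : (0 < l < n)%N -> \sum_(0 <= j < n) (both l j)%:R * g j <= 1.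
Proof.
move=> ln; apply: le_trans (flow_le1 ln); case/andP: ln => l0 ln.
rewrite (eq_bigr (fun j => \sum_(0 <= p < l) \sum_(l <= q < n)
    (A p q)%:R * ((p < j <= q)%N%:R * g j))); last first.
  move=> j _; rewrite (bothE _ (ltnW ln)) natr_sum mulr_suml; apply: eq_bigr => p _.
  rewrite natr_sum mulr_suml; apply: eq_bigr => q _.
  by rewrite natrM [X in X * _]mulrC mulrA.
rewrite exchange_big_nat /= ler_sum_nat // => p /andP[_ pl].
rewrite exchange_big_nat /= ler_sum_nat // => q /andP[lq qn].
rewrite -mulr_sumr ler_wpM2l // -gap_telescope; last by lia.
rewrite (big_nat_widen p.+1 q.+1 n) // (big_nat_widenl p.+1 0) //= [leRHS]big_mkcond /=.
 apply: ler_sum_nat => j _; rewrite ltnS andbC.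
by case: ifP => _; rewrite ?mul1r ?mul0r.
Qed.

Lemma cut_gap i : (0 < i < n)%N -> (k i)%:R * g i <= 1.
Proof.
move=> i0n; apply: le_trans (flow_gaps i0n).
have lin : (i < n)%N by case/andP: i0n.
rewrite big_mkord (bigD1 (Ordinal lin)) //= minnn maxnn lerDl.
by apply: sumr_ge0 => j _; rewrite mulr_ge0 // gap_ge0.
Qed.

Lemma sum_nat_window (F : nat -> R) a b : (a <= b <= n)%N ->
  (forall j, (j < n)%N -> 0 <= F j) ->
  \sum_(a <= j < b) F j <= \sum_(0 <= j < n) F j.
Proof.
move=> /andP[ab bn] F0; rewrite (@big_cat_nat _ _ _ a 0 n) ?(leq_trans ab) //=.
rewrite (@big_cat_nat _ _ _ b a n) //= addrCA lerDl addr_ge0 //.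
  by rewrite big_nat_cond sumr_ge0 // => j; rewrite andbT => /andP[_ ja]; apply: F0; lia.
by rewrite big_nat_cond sumr_ge0 // => j; rewrite andbT => /andP[_ ja]; apply: F0; lia.
Qed.

Lemma window_gap i : (0 < i)%N -> (i + d < n)%N ->
  (d - k i)%:R * \sum_(i.+1 <= j < (i + d).+1) g j <= 2.
Proof.
move=> i0 idn; have [->|d0] := posnP d.
  by rewrite addn0 big_geq // mulr0.
have h1 : (0 < i.+1 < n)%N by lia.
have h2 : (0 < i + d < n)%N by lia.
have -> : (2 : R) = 1 + 1 by ring.
apply: le_trans (lerD (flow_gaps h1) (flow_gaps h2)).
rewrite -big_split /= mulr_sumr.
have ab : (i.+1 <= (i + d).+1 <= n)%N by lia.
apply: le_trans (sum_nat_window ab _); last first.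
  by move=> j jn; rewrite addr_ge0 // mulr_ge0 // gap_ge0.
apply: ler_sum_nat => j /andP[ij jd]; rewrite -mulrDl ler_wpM2r ?gap_ge0 //; first lia.
(* The window estimate is taken with [m = j - i]; its last two terms count the edges that cross [j]
   together with cut [i+1] or cut [i+d]. *)
rewrite -natrD ler_nat; have := @edges_leave_window A n d sA iA regA i (j - i) idn.
have -> : (i + (j - i) = j)%N by lia.
have -> : minn i.+1 j = i.+1 by lia.
have -> : maxn i.+1 j = j by lia.
have -> : minn (i + d) j = j by lia.
have -> : maxn (i + d) j = (i + d)%N by lia.
by move=> H; have {H} : (0 < j - i <= d)%N -> _ := H; lia.
Qed.

Hypothesis connA : forall i, (0 < i < n)%N -> (0 < k i)%N.
Hypotheses (d2 : (2 <= d)%N) (n3 : (3 <= n)%N).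
Let b : R := 3 / (2 * d%:R).

Lemma big_cut_gap i : (0 < i < n)%N -> (2 * d <= 3 * k i)%N -> g i <= b.
Proof.
move=> i0n big; have := cut_gap i0n; have g0 := @gap_ge0 i.
have d0 : (0 : R) < d%:R by rewrite ltr0n; lia.
move: big; rewrite -(ler_nat R) !natrM => big h.
rewrite /b ler_pdivlMr; last by lra.
have : g i * (2 * d%:R) <= g i * (3 * (k i)%:R) by rewrite ler_wpM2l // g0 //; lia.
lra.
Qed.

(** Here [x] is the weight at cut [i] and [y] the increase per cut. The right side is the sum of
    [b w + y * 9/(4d)] over the weights [w = x, x + y, ..., x + y d]; the allowance [9/(4d)] pays
    for giving all [d] later gaps the largest weight. *)
Lemma small_cut_block i (x y : R) : (0 < i < n)%N -> (3 * k i < 2 * d)%N ->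
  0 <= x -> 0 <= y ->
  (x * g i + (x + y * d%:R) * \sum_(i.+1 <= j < (i + d).+1) g j <=
   (d.+1)%:R * (b * x + y * (9 / (4 * d%:R))) + b * y * (d%:R * (d.+1)%:R / 2)) /\ (i + d < n)%N.
Proof.
move=> i0n sm x0 y0; have k0 := connA i0n.
have d3 : (3 <= d)%N.
  (* For [d = 2] a small cut would be a single edge, against parity. *)
  rewrite leqNgt; apply/negP => d3; have e2 : d = 2%N by lia.
  have := @cut_parity A n d sA iA regA i; rewrite e2 /=.
  have -> : k i = 1%N by lia.
  by move=> /(_ ltac:(lia) isT).
have idn : (i + d < n)%N by apply: (@small_cut_room A n d sA iA regA) => //; case/andP: i0n.
split=> //; have g1 := cut_gap i0n; have := window_gap _ idn.
move=> /(_ ltac:(lia)); set W := \sum_(_ <= _ < _) _ => hW.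
have W0 : 0 <= W.
  by rewrite /W big_nat_cond sumr_ge0 // => j; rewrite andbT => /andP[_ ja]; apply: gap_ge0; lia.
have gi0 : 0 <= g i by apply: gap_ge0; lia.
have dr : (3 : R) <= d%:R by rewrite ler_nat.
(* For [k i = 1] the left side is at most [1 + 2/(d-1) = (d+1)/(d-1)]; otherwise it is at most
   [1/2 + 1]. *)
have hA : g i + W <= (d.+1)%:R * b.
  rewrite /b mulrA ler_pdivlMr; last lra.
  have [k1|k2] := leqP (k i) 1.
    have ek : k i = 1%N by lia.
    have d1 : (1 <= d)%N by lia.
    rewrite ek mul1r in g1; rewrite ek (natrB _ d1) in hW.
    rewrite -natr1; nra.
  have kd : (2 <= d - k i)%N by lia.
  have : 2%:R * g i <= 1 by apply: le_trans g1; rewrite ler_wpM2r // ler_nat.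
  have : 2%:R * W <= 2 by apply: le_trans hW; rewrite ler_wpM2r // ler_nat.
  rewrite -natr1; nra.
(* A small cut has [3 (d - k i) > d], hence [W <= 6/(d+1)]. What remains is
   [8 d^2 <= (d+1)^2 (d+3)], which follows from [d^2 (d-3) >= 0]. *)
have hB : d%:R * W <= (d.+1)%:R * (9 / (4 * d%:R)) + b * (d%:R * (d.+1)%:R / 2).
  have : (d.+1 <= 3 * (d - k i))%N by lia.
  rewrite -(ler_nat R) natrM => h3.
  have hW' : (d.+1)%:R * W <= 6.
    apply: (@le_trans _ _ (3%:R * (d - k i)%:R * W)); first by rewrite ler_wpM2r.
    by rewrite -mulrA; lra.
  have -> : (d.+1)%:R * (9 / (4 * d%:R)) + b * (d%:R * (d.+1)%:R / 2) =
     3 * d.+1%:R * (3 + d%:R) / (4 * d%:R).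
    by rewrite /b; field; lra.
  rewrite ler_pdivlMr; last lra.
  rewrite -natr1 in hW' *.
  set D := d%:R in dr hW' *.
  rewrite -(@ler_pM2l _ (D + 1)); last lra.
  have : 4 * D * D * ((D + 1) * W) <= 4 * D * D * 6 by rewrite ler_wpM2l //; nra.
  have : 0 <= D * D * (D - 3) by rewrite !mulr_ge0 //; lra.
  lra.
have : x * (g i + W) <= x * (d.+1%:R * b) by rewrite ler_wpM2l.
have : y * (d%:R * W) <= y * (d.+1%:R * (9 / (4 * d%:R)) + b * (d%:R * d.+1%:R / 2)).
  by rewrite ler_wpM2l.
lra.
Qed.

Lemma sum_arith i m : \sum_(i <= j < i + m) (j%:R : R) = m%:R * i%:R + m%:R * (m%:R - 1) / 2.
Proof.
elim: m => [|m IH]; first by rewrite addn0 big_geq // !mul0r addr0.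
by rewrite addnS big_nat_recr ?leq_addr //= IH natrD -!natr1; field.
Qed.

(* Greedy scan of the cuts: a gap at a small cut is grouped with the d gaps that
   follow it. *)
Lemma weighted_gaps (x y : R) i : (0 < i)%N -> 0 <= x -> 0 <= y ->
  \sum_(i <= j < n) (x + y * j%:R) * g j <=
  \sum_(i <= j < n) (b * (x + y * j%:R) + y * (9 / (4 * d%:R))).
Proof.
move=> i0 x0 y0; have [m] := ubnP (n - i); elim: m i i0 => // m IH i i0 lem.
have [ni|lin] := leqP n i; first by rewrite !big_geq.
have d0 : (0 : R) < d%:R by rewrite ltr0n; lia.
have c0 : 0 <= y * (9 / (4 * d%:R)) by rewrite mulr_ge0 // divr_ge0 //; lra.
have xy0 j : 0 <= x + y * j%:R by rewrite addr_ge0 // mulr_ge0.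
have [big|sm] := leqP (2 * d) (3 * k i).
  rewrite !(big_ltn lin) lerD ?IH //; last lia.
  have := @big_cut_gap i; rewrite i0 lin => /(_ isT big) gb.
  have := ler_wpM2l (xy0 i) gb; lra.
have i0n : (0 < i < n)%N by rewrite i0.
have [blk idn] := small_cut_block i0n sm (xy0 i) y0.
rewrite !(@big_cat_nat _ _ _ (i + d).+1 i n) //=; try lia.
apply: lerD; last by apply: IH; lia.
rewrite [leRHS]big_split /= -mulr_sumr big_split /= -mulr_sumr !sumr_const_nat.
rewrite -addnS sum_arith addnS big_ltn; last lia.
(* All [d] later weights are rounded up to the one at cut [i + d]. *)
apply: le_trans (_ : _ <= (x + y * i%:R) * g i + (x + y * i%:R + y * d%:R) *
   \sum_(i.+1 <= j < (i + d).+1) g j) _.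
  rewrite lerD2l mulr_sumr; apply: ler_sum_nat => j /andP[ij jd].
  rewrite ler_wpM2r ?gap_ge0 //; first lia.
  by rewrite -addrA -mulrDr lerD2l ler_wpM2l // -natrD ler_nat; lia.
apply: le_trans blk _.
have -> : ((i + d).+1 - i = d.+1)%N by lia.
rewrite -(mulr_natr x) -(mulr_natr (y * _)) -natr1 le_eqVlt; apply/orP; left; apply/eqP.
by rewrite /b; field; lra.
Qed.

(** Summation by parts: [g j] is counted once for each of the [j] vertices before cut [j]. These
    weights cost [3/2 * n (n-1) / 2 + 9/4 * (n-1)] in all; the second term turns the factor [n] into
    [n + 3]. *)
Lemma sum_drop_le : d%:R * \sum_(0 <= p < n) (f p - f n.-1) <= 3 / 4 * (n%:R - 1) * (n%:R + 3).
Proof.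
have d0 : (0 : R) < d%:R by rewrite ltr0n; lia.
have -> : \sum_(0 <= p < n) (f p - f n.-1) = \sum_(1 <= j < n) (0 + 1 * j%:R) * g j.
  have n0 : (0 < n)%N by lia.
  rewrite -{1 3}(prednK n0); elim: n.-1 => [|m IH].
    by rewrite big_nat1 big_geq // subrr.
  rewrite big_nat_recr //= subrr addr0 [RHS]big_nat_recr //= -IH.
  rewrite add0r mul1r mulrC mulr_natr -[X in _ *+ X]subn0 -sumr_const_nat -big_split /=.
  by apply: eq_bigr => j _; rewrite /g /=; ring.
have := @weighted_gaps 0 1 1 isT (lexx _) ler01.
rewrite [X in _ <= X]big_split /= -mulr_sumr big_split /= -mulr_sumr !sumr_const_nat.
have n0 : (0 < n)%N by lia.
have := sum_arith 1 n.-1; rewrite add1n (prednK n0) => -> h.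
have en : n.-1%:R = n%:R - 1 :> R by rewrite -subn1 natrB.
apply: le_trans (ler_wpM2l (ltW d0) h) _.
rewrite -(mulr_natr (1 * _)) mul0rn subn1 en le_eqVlt; apply/orP; left; apply/eqP.
by rewrite /b; field; lra.
Qed.

(* The constant [-3] comes from [g 1 + g 2 <= b], where [b] bounds a single gap
   on average. *)
Lemma total_drop_le : d%:R * (f 0%N - f n.-1) <= 3 / 2 * n%:R - 3.
Proof.
have d0 : (2 : R) <= d%:R by rewrite ler_nat.
have n1 : (1 < n)%N by lia.
have n0 : (0 < n)%N by lia.
have -> : f 0%N - f n.-1 = g 1%N + g 2%N + \sum_(3 <= j < n) g j.
  rewrite -gap_telescope // (prednK n0) (big_ltn n1) big_ltn; last lia.
  exact: addrA.
have h3 : \sum_(3 <= j < n) g j <= b * (n - 3)%:R.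
  have := @weighted_gaps 1 0 3 isT ler01 (lexx _).
  rewrite (eq_bigr g); last by move=> j _; rewrite mul0r addr0 mul1r.
  move=> h; apply: le_trans h _; rewrite (eq_bigr (fun=> b)); last by move=> j _; ring.
  by rewrite sumr_const_nat mulr_natr.
have g1 : 0 <= g 1%N by apply: gap_ge0.
have g2 : 0 <= g 2%N by apply: gap_ge0.
have r0 := regA n0; rewrite (big_ltn n0) iA add0n in r0.
have k1 : k 1 = d by rewrite edges_row.
have e1 : (d - 1 <= edges A 0 1 2 n)%N.
  by rewrite edges_row -r0 (big_ltn n1); case: (A 0%N 1%N); lia.
have k2 : (2 * (d - 1) <= k 2)%N.
  have := @cut_prefix_lb A n d sA iA regA 2 n1 => /=; lia.
have f1 : (k 1)%:R * g 1%N + (edges A 0 1 2 n)%:R * g 2%N <= 1.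
  have := @flow_gaps 1 n1.
  have ab : (1 <= 3 <= n)%N by lia.
  move=> h; apply: le_trans h; apply: le_trans (sum_nat_window ab _); last first.
    by move=> j jn; rewrite mulr_ge0 // gap_ge0.
  by rewrite (@big_ltn _ _ _ 1 3) // (@big_ltn _ _ _ 2 3) // big_geq //= addr0.
have f2 : (edges A 0 1 2 n)%:R * g 1%N + (k 2)%:R * g 2%N <= 1.
  have := @flow_gaps 2 n3.
  have ab : (1 <= 3 <= n)%N by lia.
  move=> h; apply: le_trans h; apply: le_trans (sum_nat_window ab _); last first.
    by move=> j jn; rewrite mulr_ge0 // gap_ge0.
  by rewrite (@big_ltn _ _ _ 1 3) // (@big_ltn _ _ _ 2 3) // big_geq //= addr0.
(* The two cuts share at least [d - 1] edges, so adding [f1] and [f2] gives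
   [(2d-2) (g 1 + g 2) <= 2], enough for [d >= 3]. For [d = 2], the bounds [2 g 1 + g 2 <= 1] and
   [2 g 2 <= 1] are combined. *)
have h12 : g 1%N + g 2%N <= b.
  rewrite /b ler_pdivlMr; last lra.
  move: e1 k2; rewrite -(ler_nat R) -(ler_nat R) natrM natrB ?(ltnW d2) // => e1 k2.
  rewrite k1 in f1.
  have [d3|d3] := leqP 3 d.
    have d3r : (3 : R) <= d%:R by rewrite ler_nat.
    have : (d%:R - 1) * g 1%N <= (edges A 0 1 2 n)%:R * g 1%N by rewrite ler_wpM2r.
    have : (d%:R - 1) * g 2%N <= (k 2)%:R * g 2%N by rewrite ler_wpM2r //; lra.
    nra.
  have ed : d%:R = 2 :> R by congr (_%:R); lia.
  rewrite ed in f1 e1 k2 *.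
  have : 1 * g 2%N <= (edges A 0 1 2 n)%:R * g 2%N by rewrite ler_wpM2r //; lra.
  have : 2 * g 2%N <= (k 2)%:R * g 2%N by rewrite ler_wpM2r //; lra.
  have : 0 <= (edges A 0 1 2 n)%:R * g 1%N by rewrite mulr_ge0.
  lra.
have := lerD h12 h3; rewrite natrB // => h.
have := ler_wpM2l (ler0n R d) h.
have -> : d%:R * (b + b * (n%:R - 3%:R)) = 3 / 2 * n%:R - 3 by rewrite /b; field; lra.
by [].
Qed.

End Gaps.

(** * Potential theory on finite graphs *)

Lemma degree_sum (G : sgraph) (x : G) : degree x = (\sum_y adj x y)%N.
Proof. by rewrite /degree -sum1dep_card big_mkcond; apply: eq_bigr => y _; case: adj. Qed.

Section Laplacian.
Variables (R : realFieldType) (G : sgraph).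
Implicit Types (f g h : G -> R) (x y u v : G).

Definition laplacian f x : R := \sum_y (adj x y)%:R * (f x - f y).

Lemma laplacian_sym f g : \sum_x g x * laplacian f x = \sum_x f x * laplacian g x.
Proof.
have E (a b : G -> R) : \sum_x a x * laplacian b x =
    \sum_x \sum_y (adj x y)%:R * (a x * b x) - \sum_x \sum_y (adj x y)%:R * (a x * b y).
  rewrite -sumrB; apply: eq_bigr => x _; rewrite -sumrB mulr_sumr.
  by apply: eq_bigr => y _; ring.
rewrite !E; congr (_ - _).
  by apply: eq_bigr => x _; apply: eq_bigr => y _; rewrite [g x * _]mulrC.
rewrite exchange_big; apply: eq_bigr => x _; apply: eq_bigr => y _.
by rewrite adj_sym [g y * _]mulrC.
Qed.

Lemma laplacian_sum f : \sum_x laplacian f x = 0.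
Proof.
have := laplacian_sym f (fun=> 1); rewrite (eq_bigr (laplacian f)) => [->|x _]; last exact: mul1r.
by rewrite big1 // => x _; rewrite /laplacian big1 ?mulr0 // => y _; rewrite subrr mulr0.
Qed.

Lemma laplacianN f x : laplacian (fun y => - f y) x = - laplacian f x.
Proof. by rewrite /laplacian -sumrN; apply: eq_bigr => y _; ring. Qed.

Lemma laplacianE f x : laplacian f x = (degree x)%:R * f x - \sum_y (adj x y)%:R * f y.
Proof.
rewrite /laplacian (eq_bigr (fun y => (adj x y)%:R * f x - (adj x y)%:R * f y)).
  rewrite sumrB -mulr_suml; congr (_ * _ - _).
  by rewrite degree_sum natr_sum.
by move=> y _; ring.
Qed.

Hypothesis conG : connected_graph G.

Lemma connected_closed (a : {pred G}) x :
  (forall y z, adj y z -> y \in a -> z \in a) -> x \in a -> forall y, y \in a.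
Proof.
move=> clo xa y; rewrite -(closed_connect _ (conG x y)) //.
by apply: intro_closed => //; exact: sym_connect_sym (@adj_sym G).
Qed.

(** At a negative minimum the condition on the Laplacian forces every neighbour to attain the
    minimum too; by connectedness this would spread to [v]. *)
Lemma minimum_principle f v : 0 <= f v -> (forall x, x != v -> 0 <= laplacian f x) ->
  forall x, 0 <= f x.
Proof.
move=> fv Lf x; case: (arg_minP f (erefl : xpredT v)) => m _ min_m.
apply: le_trans (min_m x isT); rewrite leNgt; apply/negP => fm.
have clo y z : adj y z -> y \in [pred w | f w == f m] -> z \in [pred w | f w == f m].
  rewrite !inE => yz /eqP fy.
  have yv : y != v by apply: contraTneq fm => yv; rewrite -fy yv -leNgt.
  have := Lf _ yv; rewrite /laplacian (bigD1 z) //= yz mul1r fy.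
  have : \sum_(w | w != z) (adj y w)%:R * (f m - f w) <= 0.
    by rewrite sumr_le0 // => w _; rewrite mulr_ge0_le0 // subr_le0 min_m.
  by have := min_m z isT => h1 h2 h3; rewrite eq_le h1 andbT; lra.
have := connected_closed clo (eqxx _ : m \in [pred w | f w == f m]) v.
by rewrite inE => /eqP E; move: fv; rewrite E leNgt fm.
Qed.

(** Dirichlet problem: the linear map that returns [f v] at [v] and the Laplacian elsewhere is
    injective, by the minimum principle for a kernel element and its negative, hence invertible. *)
Lemma laplacian_solve v g : exists2 f, f v = 0 & forall x, x != v -> laplacian f x = g x.
Proof.
pose n := #|G|.
pose op f x := if x == v then f v else laplacian f x.
pose M : 'M[R]_n := \matrix_(j, i) op (fun y => (y == enum_val j)%:R) (enum_val i).
pose fn (w : 'rV[R]_n) x := w 0 (enum_rank x).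
have lin w x : op (fn w) x = (w *m M) 0 (enum_rank x).
  rewrite mxE (reindex (@enum_rank G)) /=; last exact: onW_bij (enum_rank_bij G).
  under eq_bigr do rewrite mxE !enum_rankK.
  rewrite /op; case: ifP => _.
    rewrite (bigD1 v) //= eqxx mulr1 big1 ?addr0 // => y yv.
    by rewrite eq_sym (negbTE yv) mulr0.
  rewrite /laplacian.
  under [RHS]eq_bigr do rewrite mulr_sumr.
  rewrite exchange_big; apply: eq_bigr => y _ /=.
  rewrite (eq_bigr (fun z => (adj x y)%:R * (fn w z * (x == z)%:R - fn w z * (y == z)%:R))).
    rewrite -mulr_sumr sumrB; congr (_ * (_ - _)).
      rewrite (bigD1 x) //= eqxx mulr1 big1 ?addr0 // => z zx.
      by rewrite eq_sym (negbTE zx) mulr0.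
    rewrite (bigD1 y) //= eqxx mulr1 big1 ?addr0 // => z zx.
    by rewrite eq_sym (negbTE zx) mulr0.
  by move=> z _; rewrite /fn; ring.
have Mu : M \in unitmx.
  rewrite unitmxE unitfE; apply/negP => /det0P[w w0 wM].
  have opw x : op (fn w) x = 0 by rewrite lin wM mxE.
  have wv : fn w v = 0 by have := opw v; rewrite /op eqxx.
  have Lw x : x != v -> laplacian (fn w) x = 0.
    by move=> xv; have := opw x; rewrite /op (negbTE xv).
  case/eqP: w0; apply/rowP => i; rewrite mxE -(enum_valK i) -/(fn w _).
  apply/eqP; rewrite eq_le; apply/andP; split; last first.
    by apply: (@minimum_principle _ v); rewrite ?wv // => x /Lw ->.
  rewrite -oppr_ge0; apply: (@minimum_principle (fun y => - fn w y) v).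
    by rewrite wv oppr0.
  by move=> x /Lw E; rewrite laplacianN E oppr0.
pose b : 'rV[R]_n := \row_i (if enum_val i == v then 0 else g (enum_val i)).
have sol x : op (fn (b *m invmx M)) x = if x == v then 0 else g x.
  by rewrite lin mulmxKV // mxE enum_rankK.
exists (fn (b *m invmx M)); first by have := sol v; rewrite /op eqxx.
by move=> x xv; have := sol x; rewrite /op (negbTE xv).
Qed.

(** The equation at [v] follows from the others, as both sides have total sum 0. *)
Lemma laplacian_solve0 v g : \sum_x g x = 0 ->
  exists2 f, f v = 0 & forall x, laplacian f x = g x.
Proof.
move=> g0; have [f fv Lf] := laplacian_solve v g; exists f => // x.
have [->|xv] := eqVneq x v; last exact: Lf.
have Ef : \sum_x laplacian f x = laplacian f v + \sum_(x | x != v) g x.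
  by rewrite (bigD1 v) //=; congr (_ + _); apply: eq_bigr => y /Lf.
have := laplacian_sum f; rewrite Ef; rewrite (bigD1 v) //= in g0; lra.
Qed.

End Laplacian.

(** * Listing the vertices by decreasing potential *)

Section Ranking.
Variables (R : realFieldType) (G : sgraph) (f : G -> R) (x0 : G).
Let s := sort (fun x y => f y <= f x) (enum G).
Definition ranked (p : nat) : G := nth x0 s p.
Definition rank (x : G) : nat := index x s.

Lemma size_ranked : size s = #|G|.
Proof. by rewrite size_sort cardE. Qed.

Lemma sum_ranked (V : nmodType) (F : G -> V) :
  \sum_x F x = \sum_(0 <= p < #|G|) F (ranked p).
Proof.
rewrite -size_ranked -(big_nth x0 xpredT) -big_enum.
by apply: perm_big; rewrite perm_sym perm_sort.
Qed.

Lemma rankK x : (rank x < #|G|)%N /\ ranked (rank x) = x.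
Proof.
have xs : x \in s by rewrite mem_sort mem_enum.
by rewrite -size_ranked /rank index_mem /ranked nth_index.
Qed.

Lemma rankedK p : (p < #|G|)%N -> rank (ranked p) = p.
Proof. by move=> pn; rewrite /rank /ranked index_uniq ?size_ranked // sort_uniq enum_uniq. Qed.

Lemma ranked_noninc p q : (p <= q < #|G|)%N -> f (ranked q) <= f (ranked p).
Proof.
case/andP=> pq qn; have tr : transitive (fun x y : G => f y <= f x).
  by move=> y x z h1 h2; apply: le_trans h2 h1.
have ss : sorted (fun x y => f y <= f x) s by apply: sort_sorted => x y; apply: le_total.
have rf : reflexive (fun x y : G => f y <= f x) by move=> x; apply: lexx.
by apply: (sorted_leq_nth tr rf x0 ss) => //; rewrite inE size_ranked // (leq_ltn_trans pq).
Qed.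

End Ranking.

(** * Unit flows and expected hitting times on regular graphs *)

Section RegularGraph.
Variables (R : realFieldType) (G : sgraph) (d : nat).
Hypotheses (conG : connected_graph G) (regG : forall x : G, degree x = d).
Hypothesis n3 : (3 <= #|G|)%N.

(** With [d <= 1], a vertex and its neighbours form a closed set of at most two vertices. *)
Lemma regular_degree_ge2 : (2 <= d)%N.
Proof.
rewrite leqNgt; apply/negP => d1.
have /card_gt0P[x _] : (0 < #|G|)%N by apply: leq_trans n3.
pose a := x |: [set y | adj x y].
have all_a : forall y, y \in a.
  apply: (@connected_closed _ conG _ x); last exact: setU11.
  move=> y z yz; rewrite !inE => /orP[/eqP yx|xy]; first by rewrite -yx yz orbT.
  have : (#|[set w | adj y w]| <= 1)%N by rewrite -/(degree y) regG.
  by move/card_le1_eqP => /(_ x z); rewrite !inE adj_sym xy => /(_ isT yz) ->; rewrite eqxx.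
have Ga : (#|G| <= #|a|)%N by apply: subset_leq_card; apply/fintype.subsetP.
have ad : (#|a| <= d.+1)%N.
  by rewrite cardsU1 -/(degree x) regG -add1n leq_add2r leq_b1.
by have := leq_trans n3 (leq_trans Ga (leq_trans ad d1)).
Qed.

Section UnitFlow.
Variables (f : G -> R) (u v : G).
Hypothesis flow_f : forall x, laplacian f x = (x == u)%:R - (x == v)%:R.
Let s := ranked f u.
Let A p q := adj (s p) (s q).

Let sA : symmetric A.
Proof. by move=> p q; apply: adj_sym. Qed.

Let iA : irreflexive A.
Proof. by move=> p; apply: adj_irr. Qed.

Let regA p : (p < #|G|)%N -> (\sum_(0 <= q < #|G|) A p q)%N = d.
Proof.
by move=> _; rewrite -(regG (s p)) degree_sum (sum_ranked f u).
Qed.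

(** If no edge crossed the cut, the first [i] vertices would be closed under adjacency. *)
Let conA i : (0 < i < #|G|)%N -> (0 < edges A 0 i i #|G|)%N.
Proof.
move=> /andP[i0 lin]; rewrite lt0n; apply/negP => /eqP e0.
pose a := [pred x | rank f x < i]%N.
have clo y z : adj y z -> y \in a -> z \in a.
  rewrite !inE => yz ya; rewrite ltnNge; apply/negP => za.
  have [ly Ey] := rankK f u y; have [lz Ez] := rankK f u z.
  move: e0; rewrite /edges big_mkord (bigD1 (Ordinal ya)) //= => /eqP.
  rewrite addn_eq0 => /andP[/eqP e0 _]; move: e0.
  rewrite (bigD1_seq (rank f z)) ?iota_uniq //=; last first.
    by rewrite mem_index_iota za.
  by rewrite /A /s Ey Ez yz.
have n0 : (0 < #|G|)%N by lia.
have := @connected_closed _ conG a (s 0) clo _ (s i).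
by rewrite !inE /s !rankedK // ltnn => /(_ i0).
Qed.

(** The Laplacian summed over the first [l] vertices is the flow through the cut, as the edges
    inside cancel in pairs. The source adds at most 1 and the sink nothing positive. *)
Let flow_le1 l : (0 < l < #|G|)%N ->
  \sum_(0 <= p < l) \sum_(l <= q < #|G|) (A p q)%:R * (f (s p) - f (s q)) <= 1.
Proof.
case/andP=> l0 ln.
have inner : \sum_(0 <= p < l) \sum_(0 <= q < l) (A p q)%:R * (f (s p) - f (s q)) = 0.
  set S := LHS; have : S = - S; last by move=> ?; lra.
  rewrite {1}/S exchange_big_nat /= -sumrN; apply: eq_bigr => p _.
  by rewrite -sumrN; apply: eq_bigr => q _; rewrite sA; ring.
have -> : \sum_(0 <= p < l) \sum_(l <= q < #|G|) (A p q)%:R * (f (s p) - f (s q)) =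
    \sum_(0 <= p < l) laplacian f (s p).
  symmetry.
  rewrite (eq_bigr (fun p => \sum_(0 <= q < l) (A p q)%:R * (f (s p) - f (s q)) +
     \sum_(l <= q < #|G|) (A p q)%:R * (f (s p) - f (s q)))) => [|p _].
    by rewrite big_split /= inner add0r.
  by rewrite /laplacian (sum_ranked f u) (@big_cat_nat _ _ _ l) // ltnW.
apply: (@le_trans _ _ (\sum_(0 <= p < #|G|) (s p == u)%:R)); last first.
  rewrite -(sum_ranked f u (fun x => (x == u)%:R)) (bigD1 u) //= eqxx big1 ?addr0 //.
  by move=> x /negbTE ->.
rewrite (@big_cat_nat _ _ _ l 0 #|G|) //=; last exact: ltnW.
apply: ler_wpDr; first by apply: sumr_ge0.
by apply: ler_sum => p _; rewrite flow_f lerBlDr lerDl.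
Qed.

Let f_bounds x : f (s #|G|.-1) <= f x <= f (s 0).
Proof.
have [lx Ex] := rankK f u x.
by rewrite -{1}Ex -{2}Ex !ranked_noninc //; lia.
Qed.

Lemma potential_drop_le x y : d%:R * (f x - f y) <= 3 / 2 * (#|G|)%:R - 3.
Proof.
have := @total_drop_le R A #|G| d (f \o s) sA iA regA (@ranked_noninc _ _ f u)
  flow_le1 conA regular_degree_ge2 n3.
apply: le_trans; rewrite ler_wpM2l //=.
have /andP[_ h1] := f_bounds x; have /andP[h2 _] := f_bounds y; lra.
Qed.

Lemma potential_sum_le y :
  d%:R * \sum_x (f x - f y) <= 3 / 4 * ((#|G|)%:R - 1) * ((#|G|)%:R + 3).
Proof.
have := @sum_drop_le R A #|G| d (f \o s) sA iA regA (@ranked_noninc _ _ f u)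
  flow_le1 conA regular_degree_ge2 n3.
apply: le_trans; rewrite ler_wpM2l // (sum_ranked f u); apply: ler_sum => p _ /=.
by rewrite lerD2l lerN2; have /andP[] := f_bounds y.
Qed.

End UnitFlow.

Let n : R := (#|G|)%:R.

Lemma sum_indic (x : G) : \sum_y (y == x)%:R = 1 :> R.
Proof. by rewrite (bigD1 x) //= eqxx big1 ?addr0 // => y /negbTE ->. Qed.

Lemma sum_mul_indic (F : G -> R) (x : G) : \sum_y F y * (y == x)%:R = F x.
Proof. by rewrite (bigD1 x) //= eqxx mulr1 big1 ?addr0 // => y /negbTE ->; rewrite mulr0. Qed.

(** Away from [v], on a [d]-regular graph, this is the first-step equation of the expected hitting
    time of [v]; the value at [v] makes the right side sum to 0. *)
Lemma expected_hitting_exists (v : G) : exists h : G -> R,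
  [/\ h v = 0, forall x, 0 <= h x & forall x, laplacian h x = d%:R * (1 - n * (x == v)%:R)].
Proof.
have [|h hv Lh] := @laplacian_solve0 R G conG v (fun x => d%:R * (1 - n * (x == v)%:R)).
  by rewrite -mulr_sumr sumrB -mulr_sumr sum_indic sumr_const -/n mulr1 subrr mulr0.
exists h; split=> //; apply: (@minimum_principle R G conG _ v); first by rewrite hv.
by move=> x /negbTE xv; rewrite Lh xv mulr0 subr0 mulr1.
Qed.

Lemma unit_flow_exists (u v : G) : exists2 f : G -> R,
  f v = 0 & forall x, laplacian f x = (x == u)%:R - (x == v)%:R.
Proof. by apply: laplacian_solve0 => //; rewrite sumrB !sum_indic subrr. Qed.

(** The symmetric Laplacian pairs [f] with [h]. The target [w] is free because one flow from [u] to
    [v] serves both [w = v] and [w = u]; the two cases together give the commute time. *)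
Lemma expected_hitting_potential (h f : G -> R) (u v w : G) :
  (forall x, laplacian h x = d%:R * (1 - n * (x == w)%:R)) ->
  (forall x, laplacian f x = (x == u)%:R - (x == v)%:R) ->
  h u - h v = d%:R * \sum_x (f x - f w).
Proof.
move=> Lh Lf; have := laplacian_sym f h.
rewrite (eq_bigr (fun x => h x * (x == u)%:R - h x * (x == v)%:R)); last first.
  by move=> x _; rewrite Lf mulrBr.
rewrite sumrB !sum_mul_indic => ->.
rewrite (eq_bigr (fun x => d%:R * f x - d%:R * n * (f x * (x == w)%:R))); last first.
  by move=> x _; rewrite Lh; ring.
rewrite sumrB -!mulr_sumr sum_mul_indic sumrB sumr_const -/n -[f w *+ _]mulr_natl -/n; ring.
Qed.

Lemma expected_hitting_le (h : G -> R) (v : G) : h v = 0 ->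
  (forall x, laplacian h x = d%:R * (1 - n * (x == v)%:R)) ->
  forall u, h u <= 3 / 4 * (n - 1) * (n + 3).
Proof.
move=> hv Lh u; have [f fv Lf] := unit_flow_exists u v.
have := expected_hitting_potential Lh Lf; rewrite hv subr0 => ->.
exact: potential_sum_le Lf v.
Qed.

Lemma expected_commute_le (h g : G -> R) (u v : G) : h v = 0 -> g u = 0 ->
  (forall x, laplacian h x = d%:R * (1 - n * (x == v)%:R)) ->
  (forall x, laplacian g x = d%:R * (1 - n * (x == u)%:R)) ->
  h u + g v <= 3 / 2 * n ^+ 2 - 3 * n.
Proof.
move=> hv gu Lh Lg; have [f fv Lf] := unit_flow_exists u v.
have := expected_hitting_potential Lh Lf; have := expected_hitting_potential Lg Lf.
rewrite hv gu subr0 sub0r => eg eh.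
have -> : h u + g v = n * (d%:R * (f u - f v)).
  have -> : g v = - (- g v) by ring.
  rewrite eg eh !sumrB !sumr_const -[f v *+ _]mulr_natl -[f u *+ _]mulr_natl -/n; ring.
have := ler_wpM2l (ler0n R #|G|) (potential_drop_le Lf u v); rewrite -/n; lra.
Qed.

End RegularGraph.

(** * Hitting times as expectations *)

Section Trajectories.
Variables (R : realType) (G : sgraph).
Implicit Types (u v y z : G).

Definition traj_cons k y (t : traj G k) : traj G k.+1 :=
  [ffun i => if unlift ord0 i is Some j then t j else y].

Definition traj_behead k (t : traj G k.+1) : traj G k := [ffun j => t (lift ord0 j)].

Lemma traj_cons0 k y (t : traj G k) : traj_cons y t ord0 = y.
Proof. by rewrite ffunE unlift_none. Qed.

Lemma traj_consS k y (t : traj G k) j : traj_cons y t (lift ord0 j) = t j.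
Proof. by rewrite ffunE liftK. Qed.

Lemma sum_traj_cons k (F : traj G k.+1 -> R) :
  \sum_x F x = \sum_y \sum_(t : traj G k) F (traj_cons y t).
Proof.
rewrite pair_bigA /= (reindex (fun p : G * traj G k => traj_cons p.1 p.2)) //=.
exists (fun x : traj G k.+1 => (x ord0, traj_behead x)) => [[y t]|x] _ /=.
  by rewrite traj_cons0; congr (_, _); apply/ffunP => j; rewrite ffunE traj_consS.
apply/ffunP => i; rewrite ffunE; case: unliftP => [j|] -> //.
by rewrite ffunE.
Qed.

(** Only [z = t ord0] contributes; written as a sum, the formula yields the first-step recursion
    [hit_lawS] by exchanging sums. *)
Lemma traj_weight_cons u y k (t : traj G k) :
  traj_weight R u (traj_cons y t) =
  (y == u)%:R * \sum_z srw_step R u z * traj_weight R z t.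
Proof.
rewrite /traj_weight traj_cons0; have [->|_] := eqVneq y u; last by rewrite !mul0r.
rewrite !mul1r big_ord_recl.
have -> : widen_ord (leqnSn k.+1) ord0 = ord0 by apply: val_inj.
rewrite traj_cons0 traj_consS (bigD1 (t ord0)) //= eqxx mul1r [X in _ + X]big1 ?addr0.
  congr (_ * _); apply: eq_bigr => i _; rewrite traj_consS.
  have -> : widen_ord (leqnSn k.+1) (lift ord0 i) = lift ord0 (widen_ord (leqnSn k) i).
    exact: val_inj.
  by rewrite traj_consS.
by move=> z /negbTE zt; rewrite eq_sym zt mul0r mulr0.
Qed.

Lemma first_visit_cons v y k (t : traj G k) :
  (traj_cons y t \in first_visit v k.+1) = (y != v) && (t \in first_visit v k).
Proof.
rewrite !inE; have -> : ord_max = lift ord0 ord_max :> 'I_k.+2 by apply: val_inj.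
rewrite traj_consS andbCA; congr (_ && _).
apply/forallP/andP => [H|[yv /forallP H] i].
  split; first by have := H ord0; rewrite traj_cons0.
  by apply/forallP => j; have := H (lift ord0 j); rewrite traj_consS.
by case: (unliftP ord0 i) => [j|] ->; rewrite ?traj_consS ?traj_cons0 ?yv ?implybT //; apply: H.
Qed.

Lemma hit_law0 u v : hit_law R u v 0 = (u == v)%:R.
Proof.
rewrite /hit_law /srw_prob (reindex (fun y : G => [ffun=> y] : traj G 0)) /=.
  rewrite (eq_bigl (pred1 v)).
    by rewrite big_pred1_eq /traj_weight big_ord0 ffunE mulr1 eq_sym.
  move=> y; rewrite !inE ffunE; case: (y == v) => //=.
  by apply/forallP => i.
exists (fun x : traj G 0 => x ord0) => [y|x] _; first by rewrite ffunE.
by apply/ffunP => i; rewrite ffunE (ord1 i).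
Qed.

Lemma hit_lawS u v k : hit_law R u v k.+1 =
  (u != v)%:R * \sum_z srw_step R u z * hit_law R z v k.
Proof.
rewrite /hit_law /srw_prob big_mkcond sum_traj_cons /=.
rewrite (bigD1 u) //= [X in _ + X]big1 ?addr0; last first.
  move=> y /negbTE yu; apply: big1 => t _.
  by rewrite traj_weight_cons yu mul0r; case: ifP.
under [in RHS]eq_bigr do rewrite mulr_sumr.
rewrite exchange_big /= mulr_sumr big_mkcond /= [RHS]big_mkcond /=.
apply: eq_bigr => t _; rewrite first_visit_cons traj_weight_cons eqxx mul1r.
by case: (u != v); rewrite ?mul1r ?mul0r //= if_same.
Qed.

End Trajectories.

(** * Tails and truncated means of the hitting time *)

Section Tail.
Variables (R : realType) (G : sgraph) (v : G).
Hypothesis step1 : forall x : G, \sum_y srw_step R x y = 1.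
Local Notation hit u k := (hit_law R u v k).

(* [tail K u] is the probability that [T_v >= K], and [trunc N u] is the
   expectation of the minimum of [T_v] and [N]. *)
Definition tail K (u : G) : R := 1 - \sum_(0 <= k < K) hit u k.
Definition trunc N (u : G) : R := \sum_(0 <= K < N) tail K.+1 u.

Lemma step_ge0 (x y : G) : 0 <= srw_step R x y.
Proof. by rewrite /srw_step divr_ge0. Qed.

Lemma hit_law_ge0 u k : 0 <= hit u k.
Proof.
elim: k u => [|k IH] u; first by rewrite hit_law0.
by rewrite hit_lawS mulr_ge0 // sumr_ge0 // => z _; rewrite mulr_ge0 ?step_ge0.
Qed.

Lemma tail0 u : tail 0 u = 1.
Proof. by rewrite /tail big_geq // subr0. Qed.

Lemma tailS K u : tail K.+1 u = (u != v)%:R * \sum_z srw_step R u z * tail K z.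
Proof.
rewrite /tail big_nat_recl // hit_law0.
under eq_bigr do rewrite hit_lawS.
have [_|_] /= := eqVneq u v; first by rewrite big1 ?mul0r ?addr0 ?subrr // => k _; rewrite mul0r.
under eq_bigr do rewrite mul1r.
rewrite exchange_big /= mul1r add0r -[in LHS](step1 u) -sumrB.
by apply: eq_bigr => z _; rewrite mulrBr mulr1 mulr_sumr.
Qed.

Lemma tail_ge0 K u : 0 <= tail K u.
Proof.
elim: K u => [|K IH] u; first by rewrite tail0.
by rewrite tailS mulr_ge0 // sumr_ge0 // => z _; rewrite mulr_ge0 ?step_ge0.
Qed.

Lemma tail_hit K u : tail K.+1 u = tail K u - hit u K.
Proof. by rewrite /tail big_nat_recr //= opprD addrA. Qed.

Lemma tail_noninc K N u : (K <= N)%N -> tail N u <= tail K u.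
Proof.
elim: N => [|N IH]; first by rewrite leqn0 => /eqP ->.
rewrite leq_eqVlt => /predU1P[->//|/IH]; apply: le_trans.
by rewrite tail_hit gerBl hit_law_ge0.
Qed.

Lemma truncS N u : trunc N.+1 u = (u != v)%:R * (1 + \sum_z srw_step R u z * trunc N z).
Proof.
rewrite /trunc; under eq_bigr do rewrite tailS.
rewrite -mulr_sumr exchange_big; congr (_ * _) => /=.
under eq_bigr do rewrite -mulr_sumr big_nat_recl // tail0 mulrDr mulr1.
by rewrite big_split /= step1.
Qed.

(** Restricting the minimum of [T_v] and [N] to the event [T_v < N] removes the value [N] on
    [T_v >= N]. *)
Lemma trunc_moment N u : \sum_(0 <= k < N) k%:R * hit u k = trunc N u - N%:R * tail N u.
Proof.
elim: N => [|N IH]; first by rewrite /trunc !big_geq // mul0r subrr.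
rewrite big_nat_recr //= IH /trunc [in RHS]big_nat_recr //= tail_hit -natr1; ring.
Qed.

Lemma trunc_ge N K u : (K <= N)%N -> K%:R * tail N u <= trunc K u.
Proof.
move=> KN; rewrite mulr_natl -[X in _ *+ X]subn0 -sumr_const_nat.
by apply: ler_sum_nat => j /andP[_ jK]; apply: tail_noninc; lia.
Qed.

(** Both sides are means restricted to [T_v < N]: of the minimum of [T_v] and [K] on the left, of
    [T_v] on the right. *)
Lemma trunc_diff_ge N K u : (K <= N)%N ->
  trunc K u - K%:R * tail N u <= trunc N u - N%:R * tail N u.
Proof.
move=> KN; rewrite /trunc [in leRHS](@big_cat_nat _ _ _ K) //=.
have : (N - K)%:R * tail N u <= \sum_(K <= j < N) tail j.+1 u.
  rewrite mulr_natl -sumr_const_nat.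
  by apply: ler_sum_nat => j /andP[_ jK]; apply: tail_noninc.
rewrite natrB //; lra.
Qed.

Section Supersolution.
Variable h : G -> R.
Hypothesis h_ge0 : forall x, 0 <= h x.
Hypothesis h_super : forall x, x != v -> 1 + \sum_y srw_step R x y * h y <= h x.

Lemma trunc_le N u : trunc N u <= h u.
Proof.
elim: N u => [|N IH] u; first by rewrite /trunc big_geq.
rewrite truncS; have [->|uv] := eqVneq u v; first by rewrite mul0r.
rewrite mul1r; apply: le_trans (h_super uv); rewrite lerD2l.
by apply: ler_sum => y _; rewrite ler_wpM2l ?step_ge0.
Qed.

(** Markov's inequality: the supersolution bounds every truncated mean, so [m * tail m u <= h u]. *)
Lemma tail_small u (e : R) : 0 < e -> exists N, forall m, (N <= m)%N -> tail m u <= e.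
Proof.
move=> e0; have [N hN] : exists N : nat, h u / e <= N%:R.
  by exists (Num.bound (h u / e)); apply: ltW; rewrite archi_boundP // divr_ge0 // ltW.
exists N.+1 => m Nm; have := le_trans (trunc_ge u (leqnn m)) (trunc_le m u).
have m0 : (0 : R) < m%:R by rewrite ltr0n; lia.
have : h u <= m%:R * e.
  by rewrite -ler_pdivrMr //; apply: le_trans hN _; rewrite ler_nat; lia.
by move=> h1 h2; rewrite -(ler_pM2l m0); apply: le_trans h2 h1.
Qed.

Lemma never_hit0 u : never_hit R u v = 0%E.
Proof.
have p0 k : true -> true -> (0%:E <= (hit u k)%:E)%E by rewrite lee_fin hit_law_ge0.
suff S : (\sum_(0 <= k <oo) (hit u k)%:E)%E = 1%:E :> \bar R by rewrite /never_hit S subee.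
apply/eqP; rewrite eq_le; apply/andP; split.
  apply: lime_le; first by apply: is_cvg_nneseries.
  apply: nearW => N; rewrite sumEFin lee_fin.
  by have := tail_ge0 N u; rewrite /tail subr_ge0.
apply/lee_addgt0Pr => e e0; have [N /(_ N (leqnn N)) tN] := tail_small u e0.
apply: (@le_trans _ _ ((\sum_(0 <= k < N) hit u k)%:E + e%:E)%E).
  by rewrite -EFinD lee_fin; move: tN; rewrite /tail; lra.
rewrite leeD2r // -sumEFin; apply: nneseries_lim_ge => k *; exact: p0.
Qed.

Lemma hitting_time_series u :
  hitting_time R u v = (\sum_(0 <= k <oo) (k%:R * hit u k)%:E)%E.
Proof. by rewrite /hitting_time never_hit0 mule0 adde0. Qed.

Lemma hitting_time_le u : (hitting_time R u v <= (h u)%:E)%E.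
Proof.
rewrite hitting_time_series; apply: lime_le.
  by apply: is_cvg_nneseries => k _ _; rewrite lee_fin mulr_ge0 ?hit_law_ge0.
apply: nearW => N; rewrite sumEFin lee_fin trunc_moment.
by apply: le_trans (trunc_le N u); rewrite gerBl mulr_ge0 ?tail_ge0.
Qed.

(** A bounded subsolution is compared with the walk stopped at the minimum of [T_v] and [N];
    trajectories that have not hit earlier cost at most [M] times the tail. The supersolution [h]
    makes the tails vanish. *)
Lemma hitting_time_ge (p : G -> R) (M : R) : 0 <= M -> (forall x, p x <= M) -> p v <= 0 ->
  (forall x, x != v -> p x <= 1 + \sum_y srw_step R x y * p y) ->
  forall u, ((p u)%:E <= hitting_time R u v)%E.
Proof.
move=> M0 pM pv p_sub u.
have lb N x : p x - M * tail N x <= trunc N x.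
  elim: N x => [|N IH] x; first by rewrite tail0 /trunc big_geq // mulr1 subr_le0.
  rewrite truncS tailS; have [->|xv] := eqVneq x v; first by rewrite !mul0r mulr0 subr0.
  rewrite !mul1r; have := p_sub x xv.
  suff : \sum_y srw_step R x y * p y - M * (\sum_z srw_step R x z * tail N z) <=
      \sum_z srw_step R x z * trunc N z by lra.
  rewrite mulr_sumr -sumrB; apply: ler_sum => y _.
  by rewrite mulrCA -mulrBr ler_wpM2l ?step_ge0.
rewrite hitting_time_series; apply/lee_addgt0Pr => e e0.
(* First [K] makes the error [M * tail K u] small; then [N], depending on [K], does the same for the
   error [K * tail N u] in [trunc_diff_ge]. *)
have [K hK] : exists K, M * tail K u <= e / 2.
  have e1 : 0 < e / (2 * (M + 1)) by rewrite divr_gt0 //; lra.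
  have [K /(_ K (leqnn K)) tK] := tail_small u e1; exists K.
  apply: le_trans (ler_wpM2l M0 tK) _.
  rewrite mulrA ler_pdivrMr; last lra.
  nra.
have [N KN hN] : exists2 N, (K <= N)%N & K%:R * tail N u <= e / 2.
  have e1 : 0 < e / (2 * (K%:R + 1)) by rewrite divr_gt0 // mulr_gt0 // ltr_wpDl.
  have [N tN] := tail_small u e1; exists (N + K)%N; first by lia.
  apply: le_trans (ler_wpM2l (ler0n R K) (tN _ (leq_addr K N))) _.
  have K0 : (0 : R) <= K%:R by [].
  rewrite mulrA ler_pdivrMr; last lra.
  nra.
apply: (@le_trans _ _ ((\sum_(0 <= k < N) k%:R * hit u k)%:E + e%:E)%E).
  by rewrite -EFinD lee_fin trunc_moment; have := trunc_diff_ge u KN; have := lb K u; lra.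
rewrite leeD2r // -sumEFin; apply: nneseries_lim_ge => k _ _.
by rewrite lee_fin mulr_ge0 ?hit_law_ge0.
Qed.

End Supersolution.
End Tail.

(** * Hitting and commute times on regular graphs *)

Section RegularWalk.
Variables (R : realType) (G : sgraph) (d : nat).
Hypotheses (conG : connected_graph G) (regG : forall x : G, degree x = d).
Hypothesis n3 : (3 <= #|G|)%N.
Let n : R := (#|G|)%:R.

Let d_gt0 : 0 < d%:R :> R.
Proof. by rewrite ltr0n; apply: ltnW; apply: (regular_degree_ge2 conG regG n3). Qed.

Lemma step_mean (p : G -> R) x :
  d%:R * (\sum_y srw_step R x y * p y) = \sum_y (adj x y)%:R * p y.
Proof.
rewrite mulr_sumr; apply: eq_bigr => y _; rewrite /srw_step regG.
by field; rewrite gt_eqF.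
Qed.

Lemma step_sum (x : G) : \sum_y srw_step R x y = 1.
Proof.
apply: (mulfI (lt0r_neq0 d_gt0)); rewrite mulr1.
under eq_bigr do rewrite -[srw_step _ _ _]mulr1.
rewrite (step_mean (fun=> 1)); under eq_bigr do rewrite mulr1.
by rewrite -natr_sum -degree_sum regG.
Qed.

Lemma laplacian_step (p : G -> R) x :
  laplacian p x = d%:R * (p x - \sum_y srw_step R x y * p y).
Proof. by rewrite laplacianE regG mulrBr step_mean. Qed.

Lemma expected_hitting_super (h : G -> R) (v : G) :
  (forall x, laplacian h x = d%:R * (1 - n * (x == v)%:R)) ->
  forall x, x != v -> 1 + \sum_y srw_step R x y * h y <= h x.
Proof.
move=> Lh x /negbTE xv; have := Lh x; rewrite laplacian_step xv mulr0 subr0.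
by move/(mulfI (lt0r_neq0 d_gt0)); lra.
Qed.

Lemma expected_hitting_bound (v : G) : exists h : G -> R,
  [/\ h v = 0, forall x, laplacian h x = d%:R * (1 - n * (x == v)%:R) &
      forall u, (hitting_time R u v <= (h u)%:E)%E].
Proof.
have [h [hv h0 Lh]] := expected_hitting_exists R d conG v.
exists h; split=> // u; apply: hitting_time_le => //; first exact: step_sum.
exact: expected_hitting_super Lh.
Qed.

Lemma regular_hitting_le (u v : G) :
  (hitting_time R u v <= (3 / 4 * (n - 1) * (n + 3))%:E)%E.
Proof.
have [h [hv Lh hu]] := expected_hitting_bound v.
by apply: le_trans (hu u) _; rewrite lee_fin (expected_hitting_le conG regG n3 hv Lh).
Qed.

Lemma regular_commute_le (u v : G) :
  (hitting_time R u v + hitting_time R v u <= (3 / 2 * n ^+ 2 - 3 * n)%:E)%E.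
Proof.
have [h [hv Lh hu]] := expected_hitting_bound v.
have [g [gu Lg gv]] := expected_hitting_bound u.
apply: le_trans (leeD (hu u) (gv v)) _.
by rewrite -EFinD lee_fin (expected_commute_le conG regG n3 hv gu Lh Lg).
Qed.

(** Divided by [d], the Laplacian bound says that [p] is at most 1 plus its mean over the
    neighbours, so [p] is a subsolution off [v]. *)
Lemma regular_hitting_ge (p : G -> R) (v : G) : p v <= 0 ->
  (forall x, x != v -> laplacian p x <= d%:R) ->
  forall u, ((p u)%:E <= hitting_time R u v)%E.
Proof.
move=> pv Lp u; have [h [hv h0 Lh]] := expected_hitting_exists R d conG v.
apply: (hitting_time_ge step_sum h0 (expected_hitting_super Lh) (M := \sum_x `|p x|)) => //.
- by apply: sumr_ge0.
- by move=> x; rewrite (bigD1 x) //= ler_wpDr ?sumr_ge0 ?ler_norm.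
- move=> x /Lp; rewrite laplacian_step -[leRHS]mulr1 ler_pM2l //; lra.
Qed.

End RegularWalk.

Section MaxTimes.
Variables (R : realType) (G : sgraph).

Lemma max_hitting_time_ge (u v : G) : (hitting_time R u v <= max_hitting_time R G)%E.
Proof.
rewrite /max_hitting_time (bigD1 u) //= le_max; apply/orP; left.
by rewrite (bigD1 v) //= le_max lexx.
Qed.

Lemma max_commute_time_ge (u v : G) :
  (hitting_time R u v + hitting_time R v u <= max_commute_time R G)%E.
Proof.
rewrite /max_commute_time (bigD1 u) //= le_max; apply/orP; left.
by rewrite (bigD1 v) //= le_max lexx.
Qed.

Lemma bigmaxe_le (F : G -> \bar R) (c : \bar R) : (forall x, (F x <= c)%E) ->
  (\big[maxe/-oo]_(x : G) F x <= c)%E.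
Proof.
move=> Fc; elim/big_ind: _ => //; first exact: leNye.
by move=> x y xc yc; rewrite ge_max xc yc.
Qed.

End MaxTimes.

(** * Necklaces *)

Section Necklace.
Variable m : nat.
Let n := (4 * m + 10)%N.

(* A chain of [m] diamonds (K4 minus the edge from first to last vertex) on
   4b+5, ..., 4b+8, joined by bridges; the end pieces are 0, ..., 4 and
   4m+5, ..., 4m+9. *)
Definition necklace_arc (i j : nat) : bool :=
  [|| [&& j == i.+1, i != 2 & i != 4 * m + 6]%N,
      (j == i.+2) && ((i %% 4 == 1) || (i %% 4 == 2))%N,
      (i == 0%N) && ((j == 2) || (j == 3)) |
      (j == 4 * m + 9)%N && ((i == 4 * m + 6)%N || (i == 4 * m + 7)%N)].

Definition necklace_edge i j := necklace_arc i j || necklace_arc j i.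

Definition necklace_adj : rel 'I_n := fun i j => necklace_edge i j.

Lemma necklace_sym : symmetric necklace_adj.
Proof. by move=> i j; rewrite /necklace_adj /necklace_edge orbC. Qed.

Lemma necklace_irr : irreflexive necklace_adj.
Proof.
move=> i; rewrite /necklace_adj /necklace_edge orbb; apply/negbTE.
by rewrite !negb_or; apply/and4P; split; lia.
Qed.

Definition necklace := SGraph necklace_sym necklace_irr.

Definition necklace_nbr (i : nat) : seq nat :=
  if (i < 5)%N then
    nth [::] [:: [:: 1; 2; 3]; [:: 0; 2; 3]; [:: 0; 1; 4]; [:: 0; 1; 4]; [:: 2; 3; 5]]%N i
  else if (4 * m + 6 <= i)%N then
    nth [::] [:: [:: 4 * m + 5; 4 * m + 8; 4 * m + 9]; [:: 4 * m + 5; 4 * m + 8; 4 * m + 9];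
      [:: 4 * m + 6; 4 * m + 7; 4 * m + 9]; [:: 4 * m + 6; 4 * m + 7; 4 * m + 8]]%N (i - (4 * m + 6))
  else if ((i %% 4 == 1) || (i %% 4 == 2))%N then [:: i.-1; i.+1; i.+2] else [:: i - 2; i.-1; i.+1]%N.

(** This case analysis trades arithmetic modulo 4 for nine end vertices and four families along the
    chain. The family [4 * b + 5] includes [b = m], the first vertex of the right end piece. *)
Lemma necklace_ind (P : nat -> seq nat -> Prop) :
  P 0 [:: 1; 2; 3]%N -> P 1 [:: 0; 2; 3]%N -> P 2 [:: 0; 1; 4]%N -> P 3 [:: 0; 1; 4]%N ->
  P 4 [:: 2; 3; 5]%N ->
  P (4 * m + 6)%N [:: 4 * m + 5; 4 * m + 8; 4 * m + 9]%N ->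
  P (4 * m + 7)%N [:: 4 * m + 5; 4 * m + 8; 4 * m + 9]%N ->
  P (4 * m + 8)%N [:: 4 * m + 6; 4 * m + 7; 4 * m + 9]%N ->
  P (4 * m + 9)%N [:: 4 * m + 6; 4 * m + 7; 4 * m + 8]%N ->
  (forall b, (b <= m)%N -> P (4 * b + 5)%N [:: 4 * b + 4; 4 * b + 6; 4 * b + 7]%N) ->
  (forall b, (b < m)%N -> P (4 * b + 6)%N [:: 4 * b + 5; 4 * b + 7; 4 * b + 8]%N) ->
  (forall b, (b < m)%N -> P (4 * b + 7)%N [:: 4 * b + 5; 4 * b + 6; 4 * b + 8]%N) ->
  (forall b, (b < m)%N -> P (4 * b + 8)%N [:: 4 * b + 6; 4 * b + 7; 4 * b + 9]%N) ->
  forall i, (i < n)%N -> P i (necklace_nbr i).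
Proof.
move=> p0 p1 p2 p3 p4 q0 q1 q2 q3 a m1 m2 z i; rewrite /n /necklace_nbr => lin.
have [i5|i5] := ltnP i 5; first by case: i i5 {lin} => [|[|[|[|[|i]]]]].
have [il|il] := leqP (4 * m + 6) i.
  have [t et] : exists t, (i = 4 * m + 6 + t)%N by exists (i - (4 * m + 6))%N; lia.
  rewrite et addKn; case: t et => [|[|[|[|t]]]] et; last lia.
  - by rewrite addn0.
  - by rewrite addnS addn0 -addnS.
  - by rewrite !addnS addn0 -!addnS.
  - by rewrite !addnS addn0 -!addnS.
have eb : exists2 b, (b <= m)%N & exists2 r, (r < 4)%N & (i = 4 * b + 5 + r)%N.
  by exists ((i - 5) %/ 4)%N; [lia | exists ((i - 5) %% 4)%N; lia].
case: eb => b bm [[|[|[|[|//]]]] _ ei].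
- have -> : (i = 4 * b + 5)%N by lia.
  rewrite ifT; last lia.
  have -> : (4 * b + 5).-1 = (4 * b + 4)%N by lia.
  have -> : (4 * b + 5).+2 = (4 * b + 7)%N by lia.
  have -> : (4 * b + 5).+1 = (4 * b + 6)%N by lia.
  exact: a.
- have -> : (i = 4 * b + 6)%N by lia.
  rewrite ifT; last lia.
  have -> : (4 * b + 6).-1 = (4 * b + 5)%N by lia.
  have -> : (4 * b + 6).+2 = (4 * b + 8)%N by lia.
  have -> : (4 * b + 6).+1 = (4 * b + 7)%N by lia.
  apply: m1; lia.
- have -> : (i = 4 * b + 7)%N by lia.
  rewrite ifF; last lia.
  have -> : (4 * b + 7).-1 = (4 * b + 6)%N by lia.
  have -> : (4 * b + 7 - 2 = 4 * b + 5)%N by lia.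
  have -> : (4 * b + 7).+1 = (4 * b + 8)%N by lia.
  apply: m2; lia.
- have -> : (i = 4 * b + 8)%N by lia.
  rewrite ifF; last lia.
  have -> : (4 * b + 8).-1 = (4 * b + 7)%N by lia.
  have -> : (4 * b + 8 - 2 = 4 * b + 6)%N by lia.
  have -> : (4 * b + 8).+1 = (4 * b + 9)%N by lia.
  apply: z; lia.
Qed.

Ltac pick_arc :=
  apply/or4P; first [constructor 1; lia | constructor 2; lia | constructor 3; lia
                    | constructor 4; lia].
Ltac pick_edge := apply/orP; first [left; pick_arc | right; pick_arc].

Lemma necklace_nbrP (i j : 'I_n) : necklace_adj i j = (nat_of_ord j \in necklace_nbr i).
Proof.
have := ltn_ord j; rewrite /necklace_adj; move: (nat_of_ord j) => {}j.
elim/necklace_ind: _ / (ltn_ord i) => [||||||||| b bm | b bm | b bm | b bm];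
  rewrite /n => jn; rewrite !inE; apply/idP/idP;
  by [case/orP=> /or4P[] H; lia | case/or3P=> /eqP ->; pick_edge].
Qed.

Lemma necklace_nbr_uniq (i : 'I_n) : uniq (necklace_nbr i).
Proof.
elim/necklace_ind: _ / (ltn_ord i) => [||||||||| b bm | b bm | b bm | b bm] //=;
  by rewrite !inE; lia.
Qed.

Lemma necklace_nbr_lt (i : 'I_n) j : j \in necklace_nbr i -> (j < n)%N.
Proof.
elim/necklace_ind: _ / (ltn_ord i) => [||||||||| b bm | b bm | b bm | b bm];
  by rewrite !inE /n; lia.
Qed.

Lemma sum_necklace (V : nmodType) (F : nat -> V) (i : 'I_n) :
  \sum_(j < n | necklace_adj i j) F j = \sum_(j <- necklace_nbr i) F j.
Proof.
rewrite (eq_bigl (fun j : 'I_n => nat_of_ord j \in necklace_nbr i)); last exact: necklace_nbrP.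
rewrite -(big_mkord (fun j => j \in necklace_nbr i)) -big_filter.
apply: perm_big; apply: uniq_perm; rewrite ?filter_uniq ?iota_uniq ?necklace_nbr_uniq //.
move=> j; rewrite mem_filter mem_index_iota /=.
by case: (boolP (j \in _)) => // /necklace_nbr_lt ->.
Qed.

Lemma necklace_regular (i : necklace) : degree i = 3.
Proof.
rewrite degree_sum; transitivity (\sum_(j < n | necklace_adj i j) 1)%N.
  by rewrite [RHS]big_mkcond; apply: eq_bigr => j _; rewrite /=; case: necklace_adj.
rewrite (sum_necklace (fun=> 1%N)) sum1_size.
by elim/necklace_ind: _ / (ltn_ord i).
Qed.

Lemma necklace_connected : connected_graph necklace.
Proof.
have n0 : (0 < n)%N by rewrite /n; lia.
suff con0 (i : necklace) : connect (@adj necklace) (Ordinal n0 : necklace) i.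
  move=> x y; apply: connect_trans (con0 y).
  by rewrite (sym_connect_sym (@adj_sym necklace)).
have [k] := ubnP (nat_of_ord i); elim: k i => // k IH i ik.
have [i0|i0] := posnP i.
  by have -> : i = Ordinal n0 by apply: val_inj.
have lt := ltn_ord i.
(* The smaller neighbour is [i - 1], except that 3 uses 0 and [4 * m + 7] uses [4 * m + 5]. *)
suff [j ji jadj] : exists2 j : 'I_n, (j < i)%N & necklace_adj j i.
  by apply: connect_trans (IH j _) (connect1 jadj); lia.
have n2 : (i - 2 < n)%N by lia.
have n1 : (i - 1 < n)%N by lia.
have [e3|ne3] := eqVneq (nat_of_ord i) 3.
  by exists (Ordinal n0); rewrite ?e3 // /necklace_adj /= e3.
have [e4|ne4] := eqVneq (nat_of_ord i) (4 * m + 7)%N.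
  by exists (Ordinal n2); rewrite /necklace_adj /=; [|pick_edge]; lia.
by exists (Ordinal n1); rewrite /necklace_adj /=; [|pick_edge]; lia.
Qed.

Lemma card_necklace : #|necklace| = n.
Proof. exact: card_ord. Qed.

(** * Lower bounds for hitting times on necklaces *)

Section Potential.
Variable R : realType.

(* Drop, from the left end piece to [i], of the potential whose flow through
   the bridge after the (b+1)-st diamond is 12(b+1), three units per vertex
   passed in the chain. *)
Definition drop_at (i : nat) : R :=
  if (i < 5)%N then 0 else if (4 * m + 5 <= i)%N then 12 * m%:R ^+ 2 + 6 * m%:R else
  let b : R := ((i - 5) %/ 4)%N%:R in
  if (i %% 4 == 1)%N then 12 * b ^+ 2 + 6 * b else
  if (i %% 4 == 0)%N then 12 * b ^+ 2 + 18 * b + 6 else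
  12 * b ^+ 2 + 12 * b + 3 / 2.

Lemma drop_left i : (i < 5)%N -> drop_at i = 0.
Proof. by rewrite /drop_at => ->. Qed.

Lemma drop_right i : (4 * m + 5 <= i)%N -> drop_at i = 12 * m%:R ^+ 2 + 6 * m%:R.
Proof. by move=> ni; rewrite /drop_at ifF ?ni //; lia. Qed.

Lemma drop_first b : (b <= m)%N -> drop_at (4 * b + 5) = 12 * b%:R ^+ 2 + 6 * b%:R.
Proof.
rewrite leq_eqVlt => /predU1P[->|bm]; first by rewrite drop_right.
rewrite /drop_at ifF; last lia.
rewrite ifF; last lia.
have -> : ((4 * b + 5 - 5) %/ 4 = b)%N by lia.
by rewrite ifT //; lia.
Qed.

Lemma drop_middle b r : (b < m)%N -> (r == 6) || (r == 7) ->
  drop_at (4 * b + r) = 12 * b%:R ^+ 2 + 12 * b%:R + 3 / 2.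
Proof.
move=> bm r67; rewrite /drop_at ifF; last lia.
rewrite ifF; last lia.
have -> : ((4 * b + r - 5) %/ 4 = b)%N by lia.
by rewrite ifF ?ifF //; lia.
Qed.

Lemma drop_last b : (b < m)%N -> drop_at (4 * b + 8) = 12 * b%:R ^+ 2 + 18 * b%:R + 6.
Proof.
move=> bm; rewrite /drop_at ifF; last lia.
rewrite ifF; last lia.
have -> : ((4 * b + 8 - 5) %/ 4 = b)%N by lia.
by rewrite ifF ?ifT //; lia.
Qed.

(** The sum is 3 on the diamonds and 0 on the end pieces, where the potential is constant. The
    excluded vertex is the target of the walk. *)
Lemma drop_laplacian (i : 'I_n) : nat_of_ord i != (4 * m + 5)%N ->
  \sum_(j <- necklace_nbr i) (drop_at j - drop_at i) <= 3.
Proof.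
have d5 : drop_at 5 = 0 by rewrite -[5%N]/(4 * 0 + 5)%N drop_first // expr0n /= !mulr0 addr0.
elim/necklace_ind: _ / (ltn_ord i) => [||||||||| b bm | b bm | b bm | b bm] im5;
  rewrite !big_cons big_nil.
1-5: by rewrite ?d5 !drop_left // !subrr !addr0.
1-4: by rewrite !drop_right ?subrr ?addr0 //; lia.
- have {}bm : (b < m)%N by rewrite ltn_neqAle bm andbT; apply: contraNneq im5 => ->.
  rewrite drop_first ?(ltnW bm) // (@drop_middle b 6) // (@drop_middle b 7) //.
  case: b bm im5 => [|b] bm im5; first by rewrite drop_left //; lra.
  have -> : (4 * b.+1 + 4 = 4 * b + 8)%N by lia.
  by rewrite drop_last ?(ltnW bm) // -natr1; lra.
- by rewrite drop_first ?(ltnW bm) // (@drop_middle b 6) // (@drop_middle b 7) // drop_last //; lra.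
- by rewrite drop_first ?(ltnW bm) // (@drop_middle b 6) // (@drop_middle b 7) // drop_last //; lra.
- have -> : (4 * b + 9 = 4 * b.+1 + 5)%N by lia.
  by rewrite drop_first // (@drop_middle b 6) // (@drop_middle b 7) // drop_last // -natr1; lra.
Qed.

Definition end_vertex (i : nat) (lt : (i < n)%N) : necklace := Ordinal lt.

Let lt4 : (4 < n)%N. Proof. by rewrite /n; lia. Qed.
Let ltn5 : (4 * m + 5 < n)%N. Proof. by rewrite /n; lia. Qed.
Let T : R := 12 * m%:R ^+ 2 + 6 * m%:R.

Let card3 : (3 <= #|necklace|)%N.
Proof. by rewrite card_necklace /n; lia. Qed.

Lemma laplacian_necklace (F : nat -> R) (i : necklace) :
  laplacian (fun j : necklace => F (nat_of_ord j)) i =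
  \sum_(j <- necklace_nbr i) (F i - F j).
Proof.
rewrite -(sum_necklace (fun j => F i - F j)) [RHS]big_mkcond /=.
by apply: eq_bigr => j _ /=; case: necklace_adj; rewrite ?mul1r ?mul0r.
Qed.

Lemma necklace_hit_right :
  (T%:E <= hitting_time R (end_vertex lt4) (end_vertex ltn5))%E.
Proof.
pose p (j : necklace) := T - drop_at (nat_of_ord j).
have -> : T = p (end_vertex lt4) by rewrite /p drop_left // subr0.
apply: (regular_hitting_ge necklace_connected necklace_regular card3).
  by rewrite /p drop_right // subrr.
move=> x xv; rewrite (laplacian_necklace (fun j => T - drop_at j)).
rewrite (eq_bigr (fun j => drop_at j - drop_at x)) => [|j _]; last by ring.
exact: drop_laplacian.
Qed.

(** This reflection swaps 4 and [4 * m + 5], so the bound for one direction transfers to the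
    other. *)
Lemma necklace_adj_rev (i j : 'I_n) : necklace_adj (rev_ord i) (rev_ord j) = necklace_adj i j.
Proof.
suff imp (x y : 'I_n) : necklace_adj x y -> necklace_adj (rev_ord x) (rev_ord y).
  by apply/idP/idP => /imp //; rewrite !rev_ordK.
have := ltn_ord x; have := ltn_ord y; rewrite /necklace_adj /=.
move: (nat_of_ord x) (nat_of_ord y) => {}x {}y; rewrite /n => yn xn.
by case/orP=> /or4P[] H; pick_edge.
Qed.

Lemma laplacian_rev (F : necklace -> R) (i : necklace) :
  laplacian (fun j : necklace => F (rev_ord j)) i = laplacian F (rev_ord i).
Proof.
rewrite /laplacian [RHS](reindex_inj rev_ord_inj); apply: eq_bigr => j _ /=.
by rewrite necklace_adj_rev.
Qed.

Lemma necklace_hit_left :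
  (T%:E <= hitting_time R (end_vertex ltn5) (end_vertex lt4))%E.
Proof.
pose q (j : necklace) := T - drop_at (nat_of_ord j).
pose p (j : necklace) := q (rev_ord j).
have e1 : rev_ord (end_vertex ltn5) = end_vertex lt4.
  by apply: val_inj => /=; rewrite /n; lia.
have e2 : rev_ord (end_vertex lt4) = end_vertex ltn5 by rewrite -e1 rev_ordK.
have -> : T = p (end_vertex ltn5) by rewrite /p e1 /q drop_left // subr0.
apply: (regular_hitting_ge necklace_connected necklace_regular card3).
  by rewrite /p e2 /q drop_right // subrr.
move=> x xv; rewrite laplacian_rev (laplacian_necklace (fun j => T - drop_at j)).
rewrite (eq_bigr (fun j => drop_at j - drop_at (rev_ord x))) => [|j _]; last by ring.
apply: drop_laplacian; apply: contra xv => /eqP E; apply/eqP.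
by rewrite -[x]rev_ordK -e1; congr rev_ord; apply: val_inj.
Qed.

Lemma necklace_max_hitting : (T%:E <= max_hitting_time R necklace)%E.
Proof. exact: le_trans necklace_hit_right (max_hitting_time_ge _ _ _). Qed.

Lemma necklace_max_commute : ((2 * T)%:E <= max_commute_time R necklace)%E.
Proof.
apply: le_trans (max_commute_time_ge R (end_vertex lt4) (end_vertex ltn5)).
by rewrite mulr2n mulrDl mul1r EFinD leeD ?necklace_hit_right ?necklace_hit_left.
Qed.

End Potential.
End Necklace.

(** * Comparison of leading coefficients and conclusion *)

Local Open Scope classical_set_scope.
Local Open Scope ring_scope.

(** If [a > c], put [e = (a - c) / 2]. Since [r] is eventually at most [e n^2], the bound leaves
    [e n^2 <= b n], which fails for large [n]. *)
Lemma quadratic_coef_le (R : realType) (a b c : R) (r : nat -> R) :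
  r =o_\oo (fun m : nat => m%:R ^+ 2 : R) ->
  (forall m, let n : R := (4 * m + 10)%N%:R in
     a * n ^+ 2 - b * n <= c * n ^+ 2 + r (4 * m + 10)%N) ->
  a <= c.
Proof.
move=> ro H; rewrite leNgt; apply/negP => ca.
pose e := (a - c) / 2; have e0 : 0 < e by rewrite /e; lra.
have /eqoP/(_ e e0)[N _ hN] := ro.
(* This makes [n = 4 * m + 10] exceed both [N] and [b / e]. *)
pose m := maxn N (Num.bound `|b / e|); have := H m => /=.
set n := (4 * m + 10)%N.
have : `|r n| <= e * `|n%:R ^+ 2| by apply: hN => /=; rewrite /n /m; lia.
rewrite (ger0_norm (exprn_ge0 _ _)) // => rn' hn; have rn := le_trans (ler_norm _) rn'.
have n0 : (0 : R) < n%:R by rewrite ltr0n /n; lia.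
have : b / e < n%:R.
  apply: le_lt_trans (ler_norm _) _; apply: lt_le_trans (archi_boundP (normr_ge0 _)) _.
  have bm : (Num.bound `|b / e| <= m)%N := leq_maxr _ _.
  by rewrite ler_nat; apply: leq_trans bm _; rewrite /n; lia.
rewrite ltr_pdivrMr // => be.
have : b * n%:R < (n%:R * e) * n%:R by rewrite ltr_pM2r.
move: rn hn; rewrite /e; nra.
Qed.

Theorem corollary1p8 (R : realType) :
  [/\ (forall (n : nat) (G : sgraph),
         (3 <= n)%N -> #|G| = n -> connected_graph G -> regular_graph G ->
         (max_hitting_time R G <= (3 / 4 * (n%:R - 1) * (n%:R + 3))%:E)%E /\
         (max_commute_time R G <= (3 / 2 * n%:R ^+ 2 - 3 * n%:R)%:E)%E),
      (forall (c : R) (r : nat -> R),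
         r =o_\oo (fun m : nat => m%:R ^+ 2 : R) ->
         (forall (n : nat) (G : sgraph),
            (3 <= n)%N -> #|G| = n -> connected_graph G -> regular_graph G ->
            (max_hitting_time R G <= (c * n%:R ^+ 2 + r n)%:E)%E) ->
         3 / 4 <= c) &
      (forall (c : R) (r : nat -> R),
         r =o_\oo (fun m : nat => m%:R ^+ 2 : R) ->
         (forall (n : nat) (G : sgraph),
            (3 <= n)%N -> #|G| = n -> connected_graph G -> regular_graph G ->
            (max_commute_time R G <= (c * n%:R ^+ 2 + r n)%:E)%E) ->
         3 / 2 <= c)].
Proof.
have reg m : regular_graph (necklace m) by exists 3; exact: necklace_regular.
split.
- move=> n G n3 Gn conG [d regG]; rewrite -Gn in n3 *; split.
    by do 2 (apply: bigmaxe_le => ?); apply: regular_hitting_le.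
  by do 2 (apply: bigmaxe_le => ?); apply: regular_commute_le.
(* With [n = 4 m + 10], [3/4 n^2 - 15 n = 12 m^2 - 75] lies below the necklace bound [12 m^2 + 6 m];
   for commute times everything doubles. *)
- move=> c r ro H; apply: (@quadratic_coef_le R _ 15 c r ro) => m /=.
  have := H _ (necklace m) _ (card_necklace m) (@necklace_connected m) (reg m).
  move=> /(_ ltac:(lia)) h; have := le_trans (necklace_max_hitting m R) h.
  rewrite lee_fin; have : (0 : R) <= m%:R by [].
  by rewrite natrD natrM; lra.
- move=> c r ro H; apply: (@quadratic_coef_le R _ 30 c r ro) => m /=.
  have := H _ (necklace m) _ (card_necklace m) (@necklace_connected m) (reg m).
  move=> /(_ ltac:(lia)) h; have := le_trans (necklace_max_commute m R) h.
  rewrite lee_fin; have : (0 : R) <= m%:R by [].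
  by rewrite natrD natrM; lra.
Qed.
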